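(* Let $\mathcal A=\langle A_\alpha:\alpha\le\omega_1\rangle$ be as described in the context. Let $\mathcal M_i$, $i\in I$, be structures of a common vocabulary, $D$ an $\omega_1$-incomplete ultrafilter on $I$, $\mathcal M=\prod_{i\in I}\mathcal M_i/D$, $f_0,\ldots,f_{n-1}\in\prod_{i\in I}M_i$, and $\phi(x_0,\ldots,x_{n-1})$ a formula of $L^d_{\mathcal A}$ (or even of $L^{d,\infty}_{\mathcal A}$). If $\{i\in I:\mathcal M_i\models\phi(f_0(i),\ldots,f_{n-1}(i))\}\in D$, then $\mathcal M\models\phi(f_0/D,\ldots,f_{n-1}/D)$.
   Context: $\mathcal A=\langle A_\alpha:\alpha\le\omega_1\rangle$ is a sequence such that each $A_\alpha$ ($\alpha<\omega_1$) is a countable dense subset of $2^\omega$ ($B\subseteq 2^\omega$ is dense if every $s\in 2^{<\omega}$ has an extension in $B$), $\alpha<\beta$ implies $A_\alpha\subsetneq A_\beta$, $A_{\omega_1}=\bigcup_{\alpha<\omega_1}A_\alpha$, and $S=\{\alpha<\omega_1:A_\alpha=\bigcup_{\beta<\alpha}A_\beta\}$ is stationary. We write $B\in\mathcal A$ if $B=A_\alpha$ for some $\alpha\le\omega_1$. Let $\tau_d=\{R_0,R_1,R_2,R_3,R_4\}$ ($R_0,R_1,R_2$ binary, $R_3,R_4$ unary). For $n<\omega$ and $\eta\in 2^n$ let $\psi_\eta(x)$ be $R_4(x)\wedge\exists y_0\ldots\exists y_n\big(R_3(y_0)\wedge R_4(y_n)\wedge\bigwedge_{i<n}R_{\eta(i)}(y_i,y_{i+1})\wedge\bigwedge_{i\le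 n}R_2(y_i,x)\big)$. For a $\tau_d$-structure $\mathcal K$, $a\in K$: $\Omega(\mathcal K,a)=\{\eta\in 2^{<\omega}:\mathcal K\models\psi_\eta(a)\}$, $\Omega(\mathcal K)=\{\eta\in 2^\omega:\exists a\in K\ \forall n\ \eta\restriction n\in\Omega(\mathcal K,a)\}$. $\Theta_{TL}$ is the first-order $\tau_d$-sentence $\exists x(R_3(x)\wedge\forall y(\neg R_4(y)\vee R_2(x,y)))\wedge\forall x\forall y(\neg R_0(x,y)\vee R_2(x,y))\wedge\forall x\forall y(\neg R_1(x,y)\vee R_2(x,y))\wedge\forall x\forall y(\neg R_2(x,y)\vee(R_4(x)\wedge R_4(y)))\wedge\forall x(\neg R_4(x)\vee R_2(x,x))\wedge\forall x\forall y\forall z(\neg R_2(x,y)\vee\neg R_2(y,z)\vee R_2(x,z))\wedge\forall x\forall y\forall z(\neg R_2(y,x)\vee\neg R_2(z,x)\vee R_2(y,z)\vee R_2(z,y))$. The quantifier $Q_{\mathcal A}$ binds two variables and applies to five formulas: for a structure $\mathcal M$, formulas $\psi_0(x_0,x_1,\bar z),\psi_1(x_0,x_1,\bar z),\psi_2(x_0,x_1,\bar z),\psi_3(x_0,\bar z),\psi_4(x_0,\bar z)$ and $\bar c\in M^k$, $\mathcal M\models(Q_{\mathcal A}x_0x_1)(\psi_0,\ldots,\psi_4)[\bar c]$ iff $\mathcal M_{\bar\psi}\models\Theta_{TL}$ and $\Omega(\mathcal M_{\bar\psi})\cap A_{\omega_1}\in\mathcal A$, where $\mathcal M_{\bar\psi}$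 is the $\tau_d$-structure with universe $M$ interpreting $R_i$ ($i=0,1,2$) as $\{(a,b)\in M^2:\mathcal M\models\psi_i(a,b,\bar c)\}$ and $R_i$ ($i=3,4$) as $\{a\in M:\mathcal M\models\psi_i(a,\bar c)\}$. $L^d_{\mathcal A}$ is the closure of first-order logic (all first-order formulas) under $\wedge$, $\vee$, $\exists x$, $\forall x$, existential second-order quantification $\exists R$, and $Q_{\mathcal A}$ (no negation beyond first-order formulas); $L^{d,\infty}_{\mathcal A}$ additionally allows conjunctions of arbitrary sets of formulas.
   Formalization: The arguments ψ_0, ψ_1, ψ_2, ψ_4 of Q_A are required to be first-order (ψ_3 may be any formula of the logic), since with arbitrary arguments Q_A can negate an existential second-order sentence and the claim fails. *)

(* Defs.v *)
From HB Require Import structures.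
From mathcomp Require Import all_boot all_order.
From mathcomp Require Import boolp classical_sets functions cardinality.
From mathcomp Require Import wochoice filter.
Set Implicit Arguments.
Unset Strict Implicit.
Unset Printing Implicit Defensive.
Local Open Scope classical_set_scope.
Local Open Scope quotient_scope.

(* [W] has order type omega_1: an uncountable well-order all of whose proper
   initial segments are countable. *)
Definition is_omega1 (d : Order.disp_t) (W : orderType d) : Prop :=
  [/\ well_order (fun a b : W => (a <= b)%O),
      forall a : W, countable [set b : W | (b < a)%O]
    & ~ countable [set: W]].

Definition unbounded (d : Order.disp_t) (W : orderType d) (C : set W) : Prop :=
  forall a : W, exists2 b, C b & (a < b)%O.

(* The two hypotheses on [a] say that [a] is a limit in which [C] is cofinal. *)
Definition order_closed (d : Order.disp_t) (W : orderType d) (C : set W) : Prop :=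
  forall a : W, (exists b : W, (b < a)%O) ->
    (forall b : W, (b < a)%O -> exists2 c, C c & (b < c < a)%O) -> C a.

Definition stationary (d : Order.disp_t) (W : orderType d) (S : set W) : Prop :=
  forall C : set W, order_closed C -> unbounded C -> S `&` C !=set0.

(* [restr eta n] is the restriction of [eta] to n = {0, ..., n - 1}. *)
Definition restr (eta : nat -> bool) (n : nat) : seq bool := mkseq eta n.

Definition dense_in_cantor (B : set (nat -> bool)) : Prop :=
  forall s : seq bool, exists2 eta, B eta & restr eta (size s) = s.

(* [A] lists the A_alpha for alpha < omega_1; A_{omega_1} is [A_top A]. *)
Definition A_top (W : Type) (A : W -> set (nat -> bool)) : set (nat -> bool) :=
  \bigcup_a A a.

Definition A_limits (d : Order.disp_t) (W : orderType d)
    (A : W -> set (nat -> bool)) : set W :=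
  [set a | A a = \bigcup_(b in [set b : W | (b < a)%O]) A b].

Definition good_sequence (d : Order.disp_t) (W : orderType d)
    (A : W -> set (nat -> bool)) : Prop :=
  [/\ forall a, countable (A a),
      forall a, dense_in_cantor (A a),
      forall a b : W, (a < b)%O -> A a `<` A b
    & stationary (A_limits A)].

Definition in_sequence (W : Type) (A : W -> set (nat -> bool))
    (B : set (nat -> bool)) : Prop :=
  (exists a, B = A a) \/ B = A_top A.

Record vocabulary := Vocabulary {
  fun_symbol : Type;
  fun_arity : fun_symbol -> nat;
  rel_symbol : Type;
  rel_arity : rel_symbol -> nat }.

Record structure (V : vocabulary) := Structure {
  universe :> Type;
  universe_nonempty : inhabited universe;
  fun_interp : forall s : fun_symbol V, ('I_(fun_arity s) -> universe) -> universe;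
  rel_interp : forall r : rel_symbol V, ('I_(rel_arity r) -> universe) -> Prop }.

(* Formulas are indexed by the number [n] of their free variables
   x_0, ..., x_{n-1}; a quantifier in a formula of index [n] binds x_n. *)
Inductive term (V : vocabulary) (n : nat) : Type :=
| Var of 'I_n
| App (s : fun_symbol V) of ('I_(fun_arity s) -> term V n).
Arguments Var {V n} _.
Arguments App {V n} s _.

Inductive fo (V : vocabulary) : nat -> Type :=
| FTrue n : fo V n
| FEq n of term V n & term V n : fo V n
| FRel n (r : rel_symbol V) of ('I_(rel_arity r) -> term V n) : fo V n
| FNot n of fo V n : fo V n
| FAnd n of fo V n & fo V n : fo V n
| FOr n of fo V n & fo V n : fo V n
| FEx n of fo V n.+1 : fo V n
| FAll n of fo V n.+1 : fo V n.
Arguments FTrue {V n}.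
Arguments FRel {V n} r _.

Definition extend (T : Type) (n : nat) (e : 'I_n -> T) (a : T) : 'I_n.+1 -> T :=
  fun j => oapp e a (unlift ord_max j).

Fixpoint eval (V : vocabulary) (n : nat) (M : structure V) (e : 'I_n -> M)
    (t : term V n) : M :=
  match t with
  | Var j => e j
  | App s ts => fun_interp (fun k => eval e (ts k))
  end.

Fixpoint fo_sat (V : vocabulary) (n : nat) (M : structure V) (phi : fo V n) :
    ('I_n -> M) -> Prop :=
  match phi with
  | FTrue _ => fun _ => True
  | FEq _ t u => fun e => eval e t = eval e u
  | FRel _ r ts => fun e => rel_interp (fun k => eval e (ts k))
  | FNot _ p => fun e => ~ fo_sat p e
  | FAnd _ p q => fun e => fo_sat p e /\ fo_sat q e
  | FOr _ p q => fun e => fo_sat p e \/ fo_sat q e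
  | FEx _ p => fun e => exists a : M, fo_sat p (extend e a)
  | FAll _ p => fun e => forall a : M, fo_sat p (extend e a)
  end.

Definition FConj (V : vocabulary) (n : nat) (s : seq (fo V n)) : fo V n :=
  foldr (@FAnd V n) FTrue s.

(* Binds the last [k] of the variables x_0, ..., x_{k+n-1}. *)
Fixpoint FExs (V : vocabulary) (n k : nat) : fo V (k + n) -> fo V n :=
  match k with
  | 0 => fun p => p
  | k'.+1 => fun p => FExs (FEx p)
  end.

Inductive tau_d_symbol := R0 | R1 | R2 | R3 | R4.

Definition tau_d_arity (r : tau_d_symbol) : nat :=
  match r with R0 | R1 | R2 => 2 | R3 | R4 => 1 end.

Definition tau_d : vocabulary :=
  @Vocabulary void (fun=> 0) tau_d_symbol tau_d_arity.

Definition tau_d_structure (M : Type) (M0 : inhabited M)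
    (P0 P1 P2 : M -> M -> Prop) (P3 P4 : M -> Prop) : structure tau_d :=
  @Structure tau_d M M0 (fun s : void => match s with end)
    (fun r : tau_d_symbol =>
       match r return ('I_(tau_d_arity r) -> M) -> Prop with
       | R0 => fun v => P0 (v ord0) (v ord_max)
       | R1 => fun v => P1 (v ord0) (v ord_max)
       | R2 => fun v => P2 (v ord0) (v ord_max)
       | R3 => fun v => P3 (v ord0)
       | R4 => fun v => P4 (v ord0)
       end).

(* Atomic tau_d-formulas on the variables x_i, x_j (i, j <= n). *)
Section Atoms.
Variable n : nat.
Let two (i j : nat) : 'I_2 -> term tau_d n.+1 :=
  tnth [tuple Var (inord i); Var (inord j)].
Let one (i : nat) : 'I_1 -> term tau_d n.+1 := fun=> Var (inord i).
Definition r0 i j : fo tau_d n.+1 := @FRel tau_d _ R0 (two i j).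
Definition r1 i j : fo tau_d n.+1 := @FRel tau_d _ R1 (two i j).
Definition r2 i j : fo tau_d n.+1 := @FRel tau_d _ R2 (two i j).
Definition r3 i : fo tau_d n.+1 := @FRel tau_d _ R3 (one i).
Definition r4 i : fo tau_d n.+1 := @FRel tau_d _ R4 (one i).
End Atoms.
Arguments r0 {n} i j.
Arguments r1 {n} i j.
Arguments r2 {n} i j.
Arguments r3 {n} i.
Arguments r4 {n} i.

Definition Theta_TL : fo tau_d 0 := FConj [::
  FEx (FAnd (r3 0) (FAll (FOr (FNot (r4 1)) (r2 0 1))));
  FAll (FAll (FOr (FNot (r0 0 1)) (r2 0 1)));
  FAll (FAll (FOr (FNot (r1 0 1)) (r2 0 1)));
  FAll (FAll (FOr (FNot (r2 0 1)) (FAnd (r4 0) (r4 1))));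
  FAll (FOr (FNot (r4 0)) (r2 0 0));
  FAll (FAll (FAll (FOr (FNot (r2 0 1)) (FOr (FNot (r2 1 2)) (r2 0 2)))));
  FAll (FAll (FAll (FOr (FNot (r2 1 0)) (FOr (FNot (r2 2 0))
                   (FOr (r2 1 2) (r2 2 1))))))].

(* Here x is x_0 and y_i is x_{i+1}. *)
Definition psi (eta : seq bool) : fo tau_d 1 :=
  let n := size eta in
  FAnd (r4 0) (@FExs tau_d 1 n.+1
    (FConj [:: r3 1;
               r4 n.+1;
               FConj [seq if nth false eta i then r1 i.+1 i.+2
                          else r0 i.+1 i.+2 | i <- iota 0 n];
               FConj [seq r2 i.+1 0 | i <- iota 0 n.+1]])).

Definition Omega_at (K : structure tau_d) (a : K) : set (seq bool) :=
  [set eta | fo_sat (psi eta) (fun=> a)].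

Definition Omega (K : structure tau_d) : set (nat -> bool) :=
  [set eta | exists a : K, forall n, Omega_at a (restr eta n)].

Definition add_rel (V : vocabulary) (k : nat) : vocabulary :=
  @Vocabulary (fun_symbol V) (@fun_arity V) (option (rel_symbol V))
    (fun r => if r is Some r' then rel_arity r' else k).

Definition expand (V : vocabulary) (k : nat) (M : structure V)
    (P : ('I_k -> M) -> Prop) : structure (add_rel V k) :=
  @Structure (add_rel V k) M (universe_nonempty M) (@fun_interp V M)
    (fun r : option (rel_symbol V) =>
       match r return ('I_(@rel_arity (add_rel V k) r) -> M) -> Prop with
       | Some r' => @rel_interp V M r'
       | None => P
       end).

(* [formula false] is L^d_A and [formula true] is L^{d,infinity}_A.

   Only first-order formulas may be negated.  The truth condition of Q_A
   contains Theta_TL, in which R_0, R_1, R_2 and R_4 occur negatively, so that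
   Q_A negates its arguments psi_0, psi_1, psi_2 and psi_4: these are required
   to be first-order.  The symbol R_3 occurs only positively in Theta_TL and in
   the formulas psi_eta, and psi_3 may be any formula of the logic.  (With
   an arbitrary psi_2, say, Q_A could express the negation of an existential
   second-order sentence, and such negations are not preserved by
   ultraproducts.) *)
Inductive formula (inf : bool) : vocabulary -> nat -> Type :=
| FO V n of fo V n : formula inf V n
| And V n of formula inf V n & formula inf V n : formula inf V n
| Or V n of formula inf V n & formula inf V n : formula inf V n
| Ex V n of formula inf V n.+1 : formula inf V n
| All V n of formula inf V n.+1 : formula inf V n
| ExRel V n (k : nat) of formula inf (add_rel V k) n : formula inf V n
| QA V n of fo V n.+2 & fo V n.+2 & fo V n.+2 & formula inf V n.+1 & fo V n.+1 :
    formula inf V n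
| BigAnd V n of inf : forall J : Type, (J -> formula inf V n) -> formula inf V n.

Fixpoint sat (W : Type) (A : W -> set (nat -> bool)) (inf : bool)
    (V : vocabulary) (n : nat) (phi : formula inf V n) :
    forall M : structure V, ('I_n -> M) -> Prop :=
  match phi with
  | FO _ _ p => fun M c => fo_sat p c
  | And _ _ p q => fun M c => sat A p c /\ sat A q c
  | Or _ _ p q => fun M c => sat A p c \/ sat A q c
  | Ex _ _ p => fun M c => exists a : M, sat A p (extend c a)
  | All _ _ p => fun M c => forall a : M, sat A p (extend c a)
  | ExRel _ _ k p => fun M c =>
      exists P : ('I_k -> M) -> Prop, @sat W A inf _ _ p (expand P) c
  | QA _ _ p0 p1 p2 p3 p4 => fun M c =>
      let N := tau_d_structure (universe_nonempty M)
        (fun a b => fo_sat p0 (extend (extend c a) b))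
        (fun a b => fo_sat p1 (extend (extend c a) b))
        (fun a b => fo_sat p2 (extend (extend c a) b))
        (fun a => sat A p3 (extend c a))
        (fun a => fo_sat p4 (extend c a)) in
      @fo_sat tau_d 0 N Theta_TL (fun j : 'I_0 => match notF (ltn_ord j) with end)
      /\ in_sequence A (Omega N `&` A_top A)
  | BigAnd _ _ _ J p => fun M c => forall j : J, sat A (p j) c
  end.

Definition omega1_incomplete (I : Type) (D : set_system I) : Prop :=
  exists2 X : nat -> set I, forall k, D (X k) & ~ D (\bigcap_k X k).

Section Ultraproduct.
Variables (I : Type) (D : set_system I) (DU : UltraFilter D).
Variables (V : vocabulary) (M : I -> structure V).

Definition eq_mod (f g : {classic forall i, M i}) : bool :=
  `[< D [set i | f i = g i] >].

Lemma eq_mod_refl : reflexive eq_mod.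
Proof.
move=> f; apply/asboolP.
by apply: filterS (@filterT _ D _) => i _ /=.
Qed.

Lemma eq_mod_sym : symmetric eq_mod.
Proof.
move=> f g; apply/asboolP/asboolP; by apply: filterS => i /= ->.
Qed.

Lemma eq_mod_trans : transitive eq_mod.
Proof.
move=> g f h /asboolP fg /asboolP gh; apply/asboolP.
by apply: filterS2 fg gh => i /= -> ->.
Qed.

Canonical eq_mod_equiv := EquivRel eq_mod eq_mod_refl eq_mod_sym eq_mod_trans.

Definition uprod : Type := {eq_quot eq_mod}.

Definition uclass (f : forall i, M i) : uprod :=
  \pi_{eq_quot eq_mod} (f : {classic forall i, M i}).

Definition urepr (x : uprod) : forall i, M i :=
  repr (x : {eq_quot eq_mod}).

Lemma uprod_nonempty : inhabited uprod.
Proof.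
apply: inhabits; apply: uclass => i.
by have /cid[a _] : exists a : M i, True by case: (universe_nonempty (M i)) => a; exists a.
Qed.

(* Interpretations are read off representatives; see [ultraproduct_fun] and
   [ultraproduct_rel] for independence of the choice. *)
Definition ultraproduct : structure V :=
  @Structure V uprod uprod_nonempty
    (fun s v => uclass (fun i => fun_interp (fun k => urepr (v k) i)))
    (fun r v => D [set i | rel_interp (fun k => urepr (v k) i)]).

Lemma uclassP (f g : forall i, M i) :
  uclass f = uclass g <-> D [set i | f i = g i].
Proof.
split=> [/eqmodP /asboolP //|h].
by apply/eqmodP/asboolP.
Qed.

Lemma urepr_near k (f : 'I_k -> forall i, M i) :
  D [set i | (fun j => urepr (uclass (f j)) i) = (fun j => f j i)].
Proof.
have H (j : 'I_k) : D [set i | urepr (uclass (f j)) i = f j i].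
  by apply/uclassP; rewrite /uclass /urepr reprK.
apply: (filterS _ (filter_forall _ H)) => i h; apply/funext => j; exact: h.
Qed.

Lemma ultraproduct_fun (s : fun_symbol V) (f : 'I_(fun_arity s) -> forall i, M i) :
  @fun_interp V ultraproduct s (fun k => uclass (f k)) =
  uclass (fun i => fun_interp (fun k => f k i)).
Proof.
by apply/uclassP; apply: filterS (urepr_near f) => i /= ->.
Qed.

Lemma ultraproduct_rel (r : rel_symbol V) (f : 'I_(rel_arity r) -> forall i, M i) :
  @rel_interp V ultraproduct r (fun k => uclass (f k)) <->
  D [set i | rel_interp (fun k => f k i)].
Proof.
split=> h; apply: filterS2 (urepr_near f) h => i /=; by [move=> ->|move=> <-].
Qed.

End Ultraproduct.
Arguments uclass {I D} DU {V M} f.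

(* Main.v *)
Require Import Defs.
From mathcomp Require Import all_boot all_order.
From mathcomp Require Import boolp classical_sets functions cardinality filter.

(** If [Q_A] holds in almost all factors, then their sets [Omega] meet every
    cone of the Cantor space, and the [Omega] of an omega_1-incomplete
    ultraproduct is the whole Cantor space: given a branch [eta], choose in the
    [i]-th factor a witness agreeing with [eta] up to a level that tends to
    infinity along the ultrafilter.  So in the ultraproduct [Omega] cuts out all
    of [A_top].  The other connectives are as in the theorem of Los, except that
    [psi_3] is preserved in one direction only; this is enough since [R3] occurs
    positively in Theta_TL and the [psi_eta]. *)

Set Implicit Arguments.
Unset Strict Implicit.
Unset Printing Implicit Defensive.
Local Open Scope classical_set_scope.

(** * Choice of witnesses and Boolean operations modulo an ultrafilter *)

Lemma extend_map (T U : Type) (n : nat) (h : T -> U) (e : 'I_n -> T) (a : T) :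
  extend (fun k => h (e k)) (h a) = fun k => h (extend e a k).
Proof. by apply/funext => k; rewrite /extend; case: unlift. Qed.

(** An existential statement may hold only in almost all factors, while an element of the product
    needs every coordinate; where no witness exists, an arbitrary point is taken. *)
Lemma total_witness (I : Type) (T : I -> Type) (P : forall i, T i -> Prop) :
  (forall i, inhabited (T i)) ->
  exists g : forall i, T i, forall i, (exists a, P i a) -> P i (g i).
Proof.
move=> T0.
have h i : exists a : T i, (exists b, P i b) -> P i a.
  have [[a Pa]|nP] := pselect (exists a, P i a); first by exists a.
  by have [a] := T0 i; exists a.
by exists (fun i => sval (cid (h i))) => i; apply: (svalP (cid (h i))).
Qed.

Section UltrafilterLemmas.
Variables (I : Type) (D : set_system I) (DU : UltraFilter D).

Lemma ultra_not (P : set I) : D (fun i => ~ P i) <-> ~ D P.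
Proof.
split=> [nP DP|nP]; last by case: (in_ultra_setVsetC P DU).
have [i []] := @filter_ex _ D _ _ (filterI nP DP); by [].
Qed.

Lemma ultra_or (P Q : set I) : D (fun i => P i \/ Q i) <-> D P \/ D Q.
Proof.
split=> [PQ|[]]; last 2 first.
- by apply: filterS => i; left.
- by apply: filterS => i; right.
have [DP|DnP] := in_ultra_setVsetC P DU; first by left.
by right; apply: filterS2 DnP PQ => i nP [].
Qed.

Lemma ultra_and (P Q : set I) : D (fun i => P i /\ Q i) <-> D P /\ D Q.
Proof.
split=> [PQ|[]]; last exact: filterI.
by split; apply: filterS PQ => i [].
Qed.

End UltrafilterLemmas.

(* [uprod] of the expansions of the [M i] is not convertible to [uprod] of the
   [M i], so ultraproducts are handled up to isomorphism; the expansion of an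
   ultraproduct then has the same class map. *)
Definition is_ultraproduct (I : Type) (D : set_system I) (V : vocabulary)
    (M : I -> structure V) (N : structure V) (cls : (forall i, M i) -> N) :=
  [/\ forall x, exists f, cls f = x,
      forall f g, cls f = cls g <-> D (fun i => f i = g i),
      forall s (v : 'I_(fun_arity s) -> forall i, M i),
        fun_interp (fun k => cls (v k)) =
        cls (fun i => fun_interp (fun k => v k i))
    & forall r (v : 'I_(rel_arity r) -> forall i, M i),
        rel_interp (fun k => cls (v k)) <->
        D (fun i => rel_interp (fun k => v k i))].

Lemma ultraproduct_is_ultraproduct (I : Type) (D : set_system I)
    (DU : UltraFilter D) (V : vocabulary) (M : I -> structure V) :
  @is_ultraproduct I D V M (ultraproduct DU M) (uclass DU).
Proof.
split.
- by move=> x; exists (urepr x); rewrite /uclass /urepr generic_quotient.reprK.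
- exact: uclassP.
- exact: ultraproduct_fun.
- exact: ultraproduct_rel.
Qed.

(** * The theorem of Los for first-order formulas *)

Section Los.
Variables (I : Type) (D : set_system I) (DU : UltraFilter D).

Section ClassMap.
Variables (V : vocabulary) (M : I -> structure V) (N : structure V).
Variables (cls : (forall i, M i) -> N) (Ncls : is_ultraproduct D cls).

Lemma cls_near (k : nat) (v w : 'I_k -> forall i, M i) :
  (fun j => cls (v j)) = (fun j => cls (w j)) ->
  D (fun i => (fun j => v j i) = (fun j => w j i)).
Proof.
case: Ncls => _ clsE _ _ vw.
have H (j : 'I_k) : D (fun i => v j i = w j i).
  by apply/clsE; apply: (congr1 (fun e => e j) vw).
by apply: (filterS _ (filter_forall _ H)) => i h; apply/funext.
Qed.

(** The meaning in the ultraproduct of a new symbol interpreted by [P i] in the factors. Quantifying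
    over the representatives [v] avoids choosing them. *)
Definition limit_pred (k : nat) (P : forall i, ('I_k -> M i) -> Prop)
    (x : 'I_k -> N) : Prop :=
  exists2 v, (fun j => cls (v j)) = x & D (fun i => P i (fun j => v j i)).

Lemma limit_predE (k : nat) (P : forall i, ('I_k -> M i) -> Prop)
    (v : 'I_k -> forall i, M i) :
  limit_pred P (fun j => cls (v j)) <-> D (fun i => P i (fun j => v j i)).
Proof.
split=> [[w /cls_near wv]|]; last by exists v.
by apply: filterS2 wv => i ->.
Qed.

Lemma los_term (n : nat) (t : term V n) (f : 'I_n -> forall i, M i) :
  eval (fun k => cls (f k)) t = cls (fun i => eval (fun k => f k i) t).
Proof.
case: Ncls => _ _ funE _.
elim: t => [//|s ts IH] /=; rewrite -funE; congr fun_interp.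
by apply/funext => k; exact: IH.
Qed.

Lemma extend_at (n : nat) (f : 'I_n -> forall i, M i) (g : forall i, M i) i :
  (fun k => extend f g k i) = extend (fun k => f k i) (g i).
Proof. by apply/funext => k; rewrite /extend; case: unlift. Qed.

End ClassMap.

Lemma los (V : vocabulary) (M : I -> structure V) (N : structure V)
    (cls : (forall i, M i) -> N) (Ncls : is_ultraproduct D cls)
    (n : nat) (p : fo V n) (f : 'I_n -> forall i, M i) :
  fo_sat p (fun k => cls (f k)) <-> D (fun i => fo_sat p (fun k => f k i)).
Proof.
have [onto clsE _ relE] := Ncls.
have M0 i := universe_nonempty (M i).
elim: p f => {n} [n|n t u|n r ts|n p IH|n p IHp q IHq|n p IHp q IHq|n p IH|n p IH] f /=.
- by split=> // _; exact: filterT.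
- by rewrite !(los_term Ncls) clsE.
- by rewrite -relE; under eq_fun do rewrite (los_term Ncls).
- by rewrite IH -ultra_not.
- by rewrite IHp IHq ultra_and.
- by rewrite IHp IHq ultra_or.
- split=> [[x]|].
    have [g <-] := onto x; rewrite extend_map IH.
    by apply: filterS => i; rewrite extend_at; exists (g i).
  have [g gP] :=
    total_witness (fun i a => fo_sat p (extend (fun k => f k i) a)) M0.
  move=> Dp; exists (cls g); rewrite extend_map IH.
  by apply: filterS Dp => i /gP; rewrite extend_at.
- split=> [Np|Dp x]; last first.
    have [g <-] := onto x; rewrite extend_map IH.
    by apply: filterS Dp => i; rewrite extend_at.
  (* [g i] is a counterexample whenever the [i]-th factor has one, so [p] at [g i] forces [p] at
     every point of that factor. *)
  have [g gP] :=
    total_witness (fun i a => ~ fo_sat p (extend (fun k => f k i) a)) M0.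
  have := Np (cls g); rewrite extend_map IH; apply: filterS => i.
  rewrite extend_at => pg a; apply: contrapT => npa.
  by apply: (gP i) pg; exists a.
Qed.

End Los.
Arguments limit_pred {I} D {V M N} cls [k] P x.

(** * Monotonicity in [R3] *)

Section MonotoneR3.
Variables (T : Type) (T0 : inhabited T) (P0 P1 P2 : T -> T -> Prop).
Variables (P3 P3' P4 : T -> Prop).
Hypothesis P3_sub : forall a, P3 a -> P3' a.
Let K := tau_d_structure T0 P0 P1 P2 P3 P4.
Let K' := tau_d_structure T0 P0 P1 P2 P3' P4.

Let mono (n : nat) (p : fo tau_d n) : Prop :=
  forall e : 'I_n -> T, @fo_sat _ _ K p e -> @fo_sat _ _ K' p e.

Let mono_and n (p q : fo tau_d n) : mono p -> mono q -> mono (FAnd p q).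
Proof. by move=> hp hq e [/hp ? /hq]. Qed.

Let mono_ex n (p : fo tau_d n.+1) : mono p -> mono (FEx p).
Proof. by move=> hp e [a /hp]; exists a. Qed.

Let mono_exs n k (p : fo tau_d (k + n)) : mono p -> mono (FExs p).
Proof. by elim: k p => //= k IH p hp; apply: IH; exact: mono_ex. Qed.

Let mono_conj (J : Type) n (F : J -> fo tau_d n) (s : seq J) :
  (forall j, mono (F j)) -> mono (FConj [seq F j | j <- s]).
Proof. by move=> hF; elim: s => //= j s IH; exact: mono_and. Qed.

Let mono_r3 n i : mono (@r3 n i).
Proof. by move=> e; exact: P3_sub. Qed.

Lemma Theta_TL_mono (e : 'I_0 -> T) :
  @fo_sat _ _ K Theta_TL e -> @fo_sat _ _ K' Theta_TL e.
Proof.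
suff : mono Theta_TL by exact.
(* Only the first conjunct mentions [R3]; the others have convertible meanings in [K] and [K']. *)
rewrite /Theta_TL /FConj /=; apply: mono_and => //; apply: mono_ex.
exact: mono_and.
Qed.

Lemma Omega_mono : Omega K `<=` Omega K'.
Proof.
suff psi_mono s : mono (psi s).
  by move=> eta [a ha]; exists a => n; exact: psi_mono (ha n).
apply: mono_and => //; apply: mono_exs; apply: mono_and.
  exact: (@mono_r3 (size s + 1)).
apply: mono_and => //; apply: mono_and; last apply: mono_and => //.
  by apply: mono_conj => i; case: nth.
by apply: mono_conj => i e.
Qed.

End MonotoneR3.

(** * Density in the factors and [Omega] of the ultraproduct *)

Lemma in_sequence_dense (d : Order.disp_t) (W : orderType d)
    (A : W -> set (nat -> bool)) (B : set (nat -> bool)) :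
  is_omega1 W -> good_sequence A -> in_sequence A B -> dense_in_cantor B.
Proof.
move=> [_ _ W_unc] [_ Adense _ _] [[a ->]//|->] s.
(* The union [A_top A] inherits density as soon as [W] has an element, which uncountability
   provides. *)
have [a _] : [set: W] !=set0.
  apply/set0P/eqP => W0; apply: W_unc; rewrite W0; exact: countable0.
by have [eta Aeta etas] := Adense a s; exists eta => //; exists a.
Qed.

Lemma restr_take (eta : nat -> bool) (m n : nat) :
  m <= n -> restr eta m = take m (restr eta n).
Proof. by move=> mn; rewrite /restr /mkseq -map_take take_iota (minn_idPl mn). Qed.

(** Let [l i] be the first [m] with [i] outside [X m], and 0 if there is none. The default occurs
    only on the intersection of all [X k], whose complement is in [D]; off it, membership in the
    first [n] sets forces [n <= l i]. *)
Lemma omega1_incomplete_level (I : Type) (D : set_system I) :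
  UltraFilter D -> omega1_incomplete D ->
  exists l : I -> nat, forall n, D (fun i => n <= l i).
Proof.
move=> DU [X DX nDX].
have hl i : exists m, (exists k, ~ X k i) -> ~ X m i /\ forall j, j < m -> X j i.
  have [h|h] := pselect (exists k, ~ X k i); last by exists 0.
  have h' : exists k, `[< ~ X k i >] by have [k ?] := h; exists k; exact/asboolP.
  exists (ex_minn h') => _; case: ex_minnP => m /asboolP nXm mmin.
  split=> // j; rewrite ltnNge => jm; apply: contrapT => nXj.
  by move/negP: jm; apply; apply: mmin; exact/asboolP.
have [l lP] := choice hl.
exists l => n.
have DXn : D (fun i => forall k : 'I_n, X k i).
  by apply: filter_forall => k; exact: DX.
apply: filterS2 ((ultra_not DU _).2 nDX) DXn => i nX Xn.
have [nXl _] : ~ X (l i) i /\ forall j, j < l i -> X j i.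
  by apply: lP; apply/not_existsP => h; apply: nX => k _; exact: contrapT.
rewrite leqNgt; apply/negP => ln; exact: nXl (Xn (Ordinal ln)).
Qed.

Lemma Omega_ultraproduct (I : Type) (D : set_system I) (K : I -> structure tau_d)
    (N : structure tau_d) (cls : (forall i, K i) -> N) :
  UltraFilter D -> omega1_incomplete D -> is_ultraproduct D cls ->
  D (fun i => dense_in_cantor (Omega (K i))) -> Omega N = [set: nat -> bool].
Proof.
move=> DU /(omega1_incomplete_level DU)[l Dl] Ncls Kdense.
apply/seteqP; split=> // eta _.
have [g gP] := total_witness
  (fun i a => forall n, n <= l i -> Omega_at a (restr eta n))
  (fun i => universe_nonempty (K i)).
(* For a fixed [n] a single first-order formula is at stake, so Los applies, and [n <= l i] holds
   almost everywhere. *)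
exists (cls g) => n; apply/(los DU Ncls _ (fun=> g)).
apply: filterS2 Kdense (Dl n) => i Ki nl; apply: gP nl.
(* One element [a] witnesses all levels of the branch [nu], which agrees with [eta] up to level
   [l i]. *)
have [nu [a ha]] := Ki (restr eta (l i)); rewrite size_mkseq => nuE.
exists a => m ml; rewrite (restr_take _ ml) -nuE -restr_take //; exact: ha.
Qed.

(** * Preservation of the full logic *)

Lemma is_ultraproduct_expand (I : Type) (D : set_system I) (V : vocabulary)
    (M : I -> structure V) (N : structure V) (cls : (forall i, M i) -> N)
    (k : nat) (P : forall i, ('I_k -> M i) -> Prop) :
  UltraFilter D -> is_ultraproduct D cls ->
  @is_ultraproduct I D (add_rel V k) (fun i => expand (P i))
    (expand (limit_pred D cls P)) cls.
Proof.
move=> DU Ncls; have [onto clsE funE relE] := Ncls.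
by split=> // -[r|] v; [exact: relE | exact: limit_predE].
Qed.

Lemma sat_ultraproduct (d : Order.disp_t) (W : orderType d) (hW : is_omega1 W)
    (A : W -> set (nat -> bool)) (hA : good_sequence A)
    (I : Type) (D : set_system I) (DU : UltraFilter D) (hD : omega1_incomplete D)
    (inf : bool) (V : vocabulary) (n : nat) (phi : formula inf V n)
    (M : I -> structure V) (N : structure V) (cls : (forall i, M i) -> N)
    (f : 'I_n -> forall i : I, M i) :
  is_ultraproduct D cls ->
  D (fun i : I => sat A phi (fun k => f k i)) ->
  sat A phi (fun k => cls (f k)).
Proof.
(* The factors and the class map are generalized because the [ExRel] case applies the induction
   hypothesis to expansions. *)
move=> Ncls; elim: phi M N cls Ncls f => {V n}
  [V n p|V n p IHp q IHq|V n p IHp q IHq|V n p IH|V n p IH|V n k p IH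
  |V n p0 p1 p2 p3 IH p4|V n hinf J p IH] M N cls Ncls f Dphi;
  have [onto clsE _ _] := Ncls; have M0 i := universe_nonempty (M i).
- exact/(los DU Ncls).
- have [Dp Dq] := (ultra_and DU _ _).1 Dphi.
  by split; [exact: IHp Dp | exact: IHq Dq].
- have [Dp|Dq] := (ultra_or DU _ _).1 Dphi.
    by left; exact: IHp Dp.
  by right; exact: IHq Dq.
- have [g gP] :=
    total_witness (fun i a => sat A p (extend (fun k => f k i) a)) M0.
  exists (cls g); rewrite extend_map; apply: IH => //.
  by apply: filterS Dphi => i /gP; rewrite extend_at.
- move=> x; have [g <-] := onto x; rewrite extend_map; apply: IH => //.
  by apply: filterS Dphi => i; rewrite extend_at.
- have [P PP] := total_witness
    (fun i (P : ('I_k -> M i) -> Prop) =>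
       @sat W A inf _ _ p (expand P) (fun j => f j i))
    (fun i => inhabits (fun=> True)).
  exists (limit_pred D cls P).
  apply: (IH _ _ _ (is_ultraproduct_expand P DU Ncls)).
  by apply: filterS Dphi => i /PP.
- pose K i := tau_d_structure (universe_nonempty (M i))
    (fun a b => fo_sat p0 (extend (extend (fun k => f k i) a) b))
    (fun a b => fo_sat p1 (extend (extend (fun k => f k i) a) b))
    (fun a b => fo_sat p2 (extend (extend (fun k => f k i) a) b))
    (fun a => sat A p3 (extend (fun k => f k i) a))
    (fun a => fo_sat p4 (extend (fun k => f k i) a)).
  pose c k := cls (f k).
  (* [K'] interprets [R3] by the limit of the truth sets of [p3] in the factors, which makes it the
     ultraproduct of the [K i]. The induction hypothesis only yields that this limit is contained in
     the truth set of [p3] in [N]. *)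
  pose P3 (x : N) := limit_pred D cls
    (fun i (v : 'I_1 -> M i) => sat A p3 (extend (fun k => f k i) (v ord0)))
    (fun=> x).
  pose K' := tau_d_structure (universe_nonempty N)
    (fun a b => fo_sat p0 (extend (extend c a) b))
    (fun a b => fo_sat p1 (extend (extend c a) b))
    (fun a b => fo_sat p2 (extend (extend c a) b))
    P3 (fun a => fo_sat p4 (extend c a)).
  have P3_sub x : P3 x -> sat A p3 (extend c x).
    case=> v vx; have <- : cls (v ord0) = x by apply: (congr1 (fun e => e ord0) vx).
    rewrite extend_map => Dp; apply: IH => //.
    by apply: filterS Dp => i; rewrite extend_at.
  have K'cls : @is_ultraproduct I D tau_d K K' cls.
    have bin p g h : fo_sat p (extend (extend c (cls g)) (cls h)) <->
        D (fun i => fo_sat p (extend (extend (fun k => f k i) (g i)) (h i))).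
      rewrite !extend_map (los DU Ncls).
      by under eq_fun do rewrite !extend_at.
    split=> //.
    case=> v /=; try exact: bin.
    + have -> : P3 (cls (v ord0)) = limit_pred D cls
          (fun i (v : 'I_1 -> M i) => sat A p3 (extend (fun k => f k i) (v ord0)))
          (fun j => cls (v j)).
        by congr (limit_pred D cls _ _); apply/funext => j; rewrite ord1.
      exact: limit_predE.
    + rewrite extend_map (los DU Ncls).
      by under eq_fun do rewrite extend_at.
  pose e0 T (j : 'I_0) : T := match notF (ltn_ord j) with end.
  have [DTheta DOmega] :
      D (fun i => fo_sat Theta_TL (e0 (K i))) /\
      D (fun i => in_sequence A (Omega (K i) `&` A_top A)).
    exact/ultra_and.
  split.
    apply: (@Theta_TL_mono N _ _ _ _ P3 _ _ P3_sub).
    rewrite -/K' (_ : (fun _ => _) = fun j => cls (fun i => e0 (K i) j)); last first.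
      by apply/funext; case.
    exact/(los DU K'cls).
  have K'top : Omega K' = [set: nat -> bool].
    apply: (Omega_ultraproduct DU hD K'cls).
    (* Density of the part of [Omega (K i)] inside [A_top A] gives density of all of it. *)
    apply: filterS DOmega => i /(in_sequence_dense hW hA) dense s.
    by have [eta [Oeta _] etas] := dense s; exists eta.
  (* Whichever member of the sequence occurs in the factors, the ultraproduct yields [A_top A]. *)
  right; apply/setIidPr => eta _.
  by apply: (Omega_mono P3_sub); rewrite -/K' K'top.
(* The set in [D] where the whole conjunction holds is contained in the one for each conjunct,
   whatever the size of [J]. *)
- move=> j; apply: IH => //.
  by apply: filterS Dphi => i /(_ j).
Qed.

Unset Implicit Arguments.

Theorem theorem20 (d : Order.disp_t) (W : orderType d) (hW : is_omega1 W)
    (A : W -> set (nat -> bool)) (hA : good_sequence A)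
    (I : Type) (V : vocabulary) (M : I -> structure V)
    (D : set_system I) (DU : UltraFilter D) (hD : omega1_incomplete D)
    (inf : bool) (n : nat) (phi : formula inf V n)
    (f : 'I_n -> forall i : I, M i) :
  D (fun i : I => sat A phi (fun k => f k i)) ->
  @sat W A inf V n phi (ultraproduct DU M) (fun k => uclass DU (f k)).
Proof.
exact: (sat_ultraproduct hW hA DU hD (ultraproduct_is_ultraproduct DU M)).
Qed.
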